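(* Let $\alpha>0$ and let $B\in\mathbb{R}^{n\times n}$ be a symmetric irreducible $M$-matrix. Consider the nonlinear eigenvalue problem of finding $(\lambda,x)\in\mathbb{R}\times\mathbb{R}^n$ with $$\alpha\,(x_1^3,\dots,x_n^3)^T+Bx=\lambda x,\qquad \|x\|_2=1 .$$ Then: (1) There exists an eigenpair $(\lambda,x)$ with $x\ge 0$. (2) The eigenvalue having an eigenvector $x\ge 0$ is unique (that is, if $(\lambda,x)$ and $(\mu,y)$ are eigenpairs with $x\ge0$ and $y\ge 0$, then $\lambda=\mu$), and any eigenvector $x\ge 0$ has no zero entries, i.e. $x>0$. Denote this eigenvalue by $\lambda_0$. (3) Every eigenvalue $\lambda$ satisfies $\lambda\ge\lambda_0>0$, and $\lambda_0$ is real geometrically simple; that is, the smallest eigenvalue $\lambda_0$ has exactly two eigenvectors, a nonnegative one and a nonpositive one.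
   Context: A pair $(\lambda,x)\in\mathbb{R}\times\mathbb{R}^n$ satisfying the displayed system is called an eigenpair; $\lambda$ is then an eigenvalue and $x$ a corresponding eigenvector (so eigenvectors have Euclidean norm $1$). Vector inequalities $x\ge0$, $x>0$ are entrywise. A matrix $B\in\mathbb{R}^{n\times n}$ is reducible if there is a nonempty proper subset $I\subset\{1,\dots,n\}$ with $b_{ij}=0$ for all $i\in I$, $j\notin I$; otherwise it is irreducible. $B$ is an $M$-matrix if $B=sI-A$ with $A$ entrywise nonnegative and $s\ge\rho(A)$, where $\rho(A)$ is the spectral radius of $A$ (so a symmetric $M$-matrix is positive semidefinite with nonpositive off-diagonal entries). An eigenvalue $\lambda$ is real geometrically simple if the maximum number of linearly independent real eigenvectors corresponding to $\lambda$ equals one. *)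

(* Defs.v *)
From mathcomp Require Import all_boot all_order all_algebra.
From mathcomp Require Import complex.
From mathcomp Require Import all_classical all_reals.

Set Implicit Arguments.
Unset Strict Implicit.
Unset Printing Implicit Defensive.

Import Order.TTheory GRing.Theory Num.Theory.

Local Open Scope classical_set_scope.
Local Open Scope ring_scope.

Definition nonneg_mx (R : realType) (m n : nat) (A : 'M[R]_(m, n)) : Prop :=
  forall i j, 0 <= A i j.

Definition pos_mx (R : realType) (m n : nat) (A : 'M[R]_(m, n)) : Prop :=
  forall i j, 0 < A i j.

Definition nonpos_mx (R : realType) (m n : nat) (A : 'M[R]_(m, n)) : Prop :=
  forall i j, A i j <= 0.

Definition norm2 (R : realType) (n : nat) (x : 'cV[R]_n) : R :=
  Num.sqrt (\sum_(i < n) x i 0 ^+ 2).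

Definition reducible_mx (R : realType) (n : nat) (B : 'M[R]_n) : Prop :=
  exists I : {set 'I_n},
    [/\ I != finset.set0, I \proper [set: 'I_n]%SET
      & forall i j, i \in I -> j \notin I -> B i j = 0].

Definition irreducible_mx (R : realType) (n : nat) (B : 'M[R]_n) : Prop :=
  ~ reducible_mx B.

(* The supremum of the moduli of the complex eigenvalues. For n > 0 this set is
   finite and nonempty, so the supremum is a maximum. *)
Definition spectral_radius (R : realType) (n : nat) (A : 'M[R]_n) : R :=
  sup [set r : R | exists z : R[i],
         eigenvalue (map_mx (real_complex R) A) z /\
         r = ComplexField.Normc.normc z].

Definition Mmatrix (R : realType) (n : nat) (B : 'M[R]_n) : Prop :=
  exists (s : R) (A : 'M[R]_n),
    [/\ B = s%:M - A, nonneg_mx A & spectral_radius A <= s].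

Definition eigenpair (R : realType) (n : nat) (alpha : R) (B : 'M[R]_n)
    (lambda : R) (x : 'cV[R]_n) : Prop :=
  alpha *: map_mx (fun t : R => t ^+ 3) x + B *m x = lambda *: x
  /\ norm2 x = 1.

Definition nl_eigenvalue (R : realType) (n : nat) (alpha : R) (B : 'M[R]_n)
    (lambda : R) : Prop :=
  exists x : 'cV[R]_n, eigenpair alpha B lambda x.

(* The vectors of the family are the transposed rows of X. *)
Definition indep_eigenvectors (R : realType) (n : nat) (alpha : R)
    (B : 'M[R]_n) (lambda : R) (k : nat) : Prop :=
  exists X : 'M[R]_(k, n),
    row_free X /\ forall i : 'I_k, eigenpair alpha B lambda (row i X)^T.

Definition geometrically_simple (R : realType) (n : nat) (alpha : R)
    (B : 'M[R]_n) (lambda : R) : Prop :=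
  indep_eigenvectors alpha B lambda 1 /\
  forall k : nat, indep_eigenvectors alpha B lambda k -> (k <= 1)%N.

(* Main.v *)
Require Import Defs.
From mathcomp Require Import all_boot all_order all_algebra.
From mathcomp Require Import complex.
From mathcomp Require Import all_classical all_reals.
From mathcomp Require Import topology normedtype derive realfun.
From mathcomp Require Import ring lra.

Import Order.TTheory GRing.Theory Num.Theory.
Import numFieldNormedType.Exports.

Local Open Scope ring_scope.

(** Write the nonlinear system as the critical point equation of the energy
    [alpha / 2 * quart x + qform B x] on the unit sphere, where [quart] is the
    sum of fourth powers and [qform B] the quadratic form of the symmetric
    matrix [B].

    Existence.  The energy is continuous and the sphere compact, so there is a
    minimizer [x] ([sphere_min]).  The off-diagonal entries of [B] are
    nonpositive, hence passing to entrywise absolute values does not increase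
    the energy ([qform_norm_le]) and [x] may be taken nonnegative.  A minimizer
    is an eigenvector ([min_critical]).

    Positivity.  In a row where a nonnegative eigenvector vanishes, the equation
    is a vanishing sum of nonpositive terms, so [B] has no entry linking the
    zero set of [x] to its complement; irreducibility makes the zero set empty
    ([nonneg_eigenvector_pos]).

    Minimality, uniqueness, simplicity.  All three come from one comparison
    ([pos_eigenvalue_minimal]).  Let [x > 0] be an eigenvector for [l] and [y]
    any eigenvector for [mu].  The vector [|y|] is a subsolution of the equation
    for [mu].  Scale [x] by the largest ratio [s = |y_i| / x_i], so that
    [|y| <= s x] with a contact at some index [i]; as both vectors have norm
    [1], [s >= 1].  Comparing row [i] of the two relations leaves
    [l + alpha (s^2 - 1) x_i^2 <= mu].  Hence [l <= mu], and [l = mu] forces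
    [s = 1], so [|y| <= x] with equal norms and [|y| = x].  Applied with [y]
    nonnegative, both ways, this gives uniqueness of the eigenvalue.  When
    [l = mu] the subsolution is a solution, so entries of [y] linked by [B] have
    equal signs, and irreducibility leaves only [y = x] and [y = - x]
    ([pos_eigenvector_sign]).

    Positivity of the eigenvalue.  An eigenvalue is
    [alpha * quart x + qform B x], and [qform B] is nonnegative on the sphere:
    its minimum there is a linear eigenvalue [m] of [B] (the case without cubic
    term of [min_critical]), so [s - m] is an eigenvalue of [A] when
    [B = s%:M - A].  It is at most the spectral radius of [A], hence at most
    [s], and so [m >= 0]. *)

(** * The energy and the eigenpair equation *)

Definition sqnorm {R : realType} {n : nat} (x : 'cV[R]_n) : R :=
  \sum_i x i 0 ^+ 2.

Definition quart {R : realType} {n : nat} (x : 'cV[R]_n) : R :=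
  \sum_i x i 0 ^+ 4.

Definition qform {R : realType} {n : nat} (B : 'M[R]_n) (x : 'cV[R]_n) : R :=
  \sum_i x i 0 * \sum_j B i j * x j 0.

Lemma sumr_sqr_eq0 {R : realType} {I : finType} (f : I -> R) :
  \sum_i f i ^+ 2 = 0 -> forall i, f i = 0.
Proof.
move=> /eqP; rewrite psumr_eq0 => [/allP f0 i|i _]; last exact: sqr_ge0.
by have := f0 i (mem_index_enum i); rewrite /= sqrf_eq0 => /eqP.
Qed.

Lemma eigenpairP {R : realType} {n : nat} (alpha : R) (B : 'M[R]_n) l x :
  eigenpair alpha B l x <->
  (forall i, alpha * x i 0 ^+ 3 + \sum_j B i j * x j 0 = l * x i 0)
  /\ sqnorm x = 1.
Proof.
rewrite /eigenpair /norm2 -/(sqnorm x); split=> -[eqx nx]; split.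
- by move=> i; move/matrixP/(_ i 0): eqx; rewrite !mxE.
- have sx : 0 <= sqnorm x by apply: sumr_ge0 => i _; exact: sqr_ge0.
  by rewrite -(sqr_sqrtr sx) nx expr1n.
- by apply/matrixP => i j; rewrite !ord1 !mxE; exact: eqx.
- by rewrite nx sqrtr1.
Qed.

Lemma eigenpair_neq0 {R : realType} {n : nat} {alpha l : R} {B : 'M[R]_n}
    {x : 'cV[R]_n} :
  eigenpair alpha B l x -> x != 0.
Proof.
move=> /eigenpairP[_ nx]; apply/eqP => x0; have /eqP := nx.
rewrite /sqnorm big1 ?[0 == 1]eq_sym ?oner_eq0 // => i _.
by rewrite x0 mxE expr0n.
Qed.

(** * Minimization of the energy on the unit sphere *)

Lemma sum_continuous {R : realType} {T : topologicalType} (I : finType)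
    (F : I -> T -> R) :
  (forall i, continuous (F i)) -> continuous (fun x => \sum_i F i x).
Proof. by move=> cF; apply: continuous_big => // p; exact: add_continuous. Qed.

(** The energy is a polynomial in the entries, and the sphere is closed in the
    cube of vectors with entries in [-1, 1], a product of compact intervals. *)
Lemma sphere_min {R : realType} {n : nat} (n_gt0 : (0 < n)%N) (c : R)
    (B : 'M[R]_n) :
  exists2 x : 'cV[R]_n, sqnorm x = 1 &
    forall y, sqnorm y = 1 ->
      c * quart x + qform B x <= c * quart y + qform B y.
Proof.
have ccoord i : continuous (fun x : 'rV[R]_n => x^T i 0).
  by under eq_fun do rewrite mxE; exact: coord_continuous.
have cexp i k : continuous (fun x : 'rV[R]_n => x^T i 0 ^+ k).
  move=> x; apply: (@continuous_comp _ _ _ (fun x : 'rV[R]_n => x^T i 0)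
    (fun t : R => t ^+ k)); [exact: ccoord | exact: exprn_continuous].
have cnorm : continuous (fun x : 'rV[R]_n => sqnorm x^T).
  by apply: sum_continuous => i; exact: cexp.
have cquart : continuous (fun x : 'rV[R]_n => quart x^T).
  by apply: sum_continuous => i; exact: cexp.
have cBx i : continuous (fun x : 'rV[R]_n => \sum_j B i j * x^T j 0).
  apply: sum_continuous => j x.
  exact: (cvgM (cvg_cst (B i j)) (ccoord j x)).
have cqform : continuous (fun x : 'rV[R]_n => qform B x^T).
  apply: sum_continuous => i x; exact: (cvgM (ccoord i x) (cBx i x)).
have cE : continuous (fun x : 'rV[R]_n => c * quart x^T + qform B x^T).
  by move=> x; exact: (cvgD (cvgM (cvg_cst c) (cquart x)) (cqform x)).
pose S := [set x : 'rV[R]_n | sqnorm x^T = 1]%classic.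
have cS : compact S.
  pose cube :=
    [set x : 'rV[R]_n | forall i, `[(-1 : R), 1]%classic (x ord0 i)]%classic.
  have clS : closed S.
    rewrite (_ : S = (fun x : 'rV[R]_n => sqnorm x^T) @^-1` [set 1])%classic //.
    by apply: closed_comp => [x _|]; [exact: cnorm | exact: closed_eq].
  have ccube : compact cube.
    apply: (@rV_compact _ _ (fun=> `[(-1 : R), 1]%classic)) => i.
    exact: segment_compact.
  apply: subclosed_compact clS ccube _ => x /= Sx i /=.
  rewrite in_itv /= -ler_norml.
  rewrite -(@ler_pXn2r _ 2) ?nnegrE // expr1n real_normK ?num_real //.
  rewrite -Sx /sqnorm (bigD1 i) //= mxE lerDl.
  by apply: sumr_ge0 => j _; exact: sqr_ge0.
have S0 : (S !=set0)%classic.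
  exists (delta_mx 0 (Ordinal n_gt0)); rewrite /S /sqnorm /=.
  rewrite (bigD1 (Ordinal n_gt0)) //= big1 ?addr0.
    by rewrite !mxE !eqxx expr1n.
  by move=> i /negPf ni; rewrite !mxE ni andbF expr0n.
have [x xS xmin] := compact_EVT_min S0 cS (continuous_subspaceT cE).
exists x^T; first by move: xS; rewrite inE.
by move=> y sy; have := xmin y^T; rewrite inE /S /= trmxK; apply.
Qed.

(** Multiplying the quadratic part by [sqnorm y] makes the energy homogeneous of
    degree 4, so that a lower bound on the sphere extends to the whole space.
    The constrained minimization thus becomes a free one, whose restriction to
    a line is a polynomial. *)
Lemma homogeneous_min {R : realType} {n : nat} (c m : R) (B : 'M[R]_n) :
  (forall y, sqnorm y = 1 -> m <= c * quart y + qform B y) ->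
  forall y, m * sqnorm y ^+ 2 <= c * quart y + qform B y * sqnorm y.
Proof.
move=> mP y.
have : 0 <= sqnorm y by apply: sumr_ge0 => i _; exact: sqr_ge0.
rewrite le_eqVlt => /predU1P[y0 | y_gt0].
  have yE i : y i 0 = 0.
    exact: (@sumr_sqr_eq0 _ _ (fun i => y i 0) (esym y0)).
  have -> : quart y = 0 by rewrite /quart big1 // => i _; rewrite yE expr0n.
  by rewrite -y0 expr0n /= !mulr0 addr0.
set N := sqnorm y in y_gt0 *.
pose s := (Num.sqrt N)^-1.
have s2 : s ^+ 2 = N^-1 by rewrite exprVn sqr_sqrtr // ltW.
have nz : N != 0 by rewrite gt_eqF.
have := mP (s *: y).
have -> : sqnorm (s *: y) = 1.
  rewrite /sqnorm (eq_bigr (fun i => s ^+ 2 * y i 0 ^+ 2)).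
    by rewrite -mulr_sumr s2 mulVf.
  by move=> i _; rewrite mxE exprMn.
have -> : quart (s *: y) = N^-1 ^+ 2 * quart y.
  rewrite /quart mulr_sumr; apply: eq_bigr => i _.
  by rewrite mxE exprMn -s2 -exprM.
have -> : qform B (s *: y) = N^-1 * qform B y.
  rewrite /qform mulr_sumr; apply: eq_bigr => i _.
  rewrite mxE (eq_bigr (fun j => s * (B i j * y j 0))).
    by rewrite -mulr_sumr -s2; ring.
  by move=> j _; rewrite mxE; ring.
move=> /(_ erefl) /(ler_wpM2r (sqr_ge0 N)).
suff -> : (c * (N^-1 ^+ 2 * quart y) + N^-1 * qform B y) * N ^+ 2
  = c * quart y + qform B y * N by [].
by field.
Qed.

Lemma deriv_at_min {R : realType} (p : {poly R}) :
  (forall t, p.[0] <= p.[t]) -> p^`().[0] = 0.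
Proof.
move=> pmin; have -> : p^`().[0] = ((horner p)^`() 0)%classic by rewrite derivE.
have [] : is_derive (0 : R) 1 (horner p) 0.
  have le11 : -1 <= 1 :> R by lra.
  have in0 : (0 : R) \in `]-1, 1[ by rewrite in_itv /= ltrN10 ltr01.
  apply: (derive1_at_min le11 _ in0) => t _; last exact: pmin.
  exact: derivable_horner.
by move=> _ d0; rewrite derive1E.
Qed.

(** This symmetry makes the two cross terms of the expansion of
    [qform B (x + t v)] equal. *)
Lemma qform_polar {R : realType} {n : nat} (B : 'M[R]_n) (x v : 'cV[R]_n) :
  B^T = B ->
  \sum_i x i 0 * \sum_j B i j * v j 0 = \sum_i v i 0 * \sum_j B i j * x j 0.
Proof.
move=> Bs; under eq_bigr do rewrite mulr_sumr.
rewrite exchange_big; apply: eq_bigr => i _; rewrite mulr_sumr.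
by apply: eq_bigr => j _; rewrite -{1}Bs mxE; ring.
Qed.

(** Along the line [x + t v] the homogenized energy minus its lower bound is a
    nonnegative polynomial [G] of [t] vanishing at [0], so [G'(0) = 0]; this
    derivative is twice the inner product of [v] with the residual of the
    eigenvalue equation.  Choosing [v] to be that residual shows that it
    vanishes.  The constant [c] is arbitrary: [c = alpha / 2] gives the nonlinear
    problem, [c = 0] the linear one. *)
Lemma min_critical {R : realType} {n : nat} (c : R) (B : 'M[R]_n)
    (x : 'cV[R]_n) :
  B^T = B -> sqnorm x = 1 ->
  (forall y, sqnorm y = 1 ->
      c * quart x + qform B x <= c * quart y + qform B y) ->
  eigenpair (2 * c) B (2 * c * quart x + qform B x) x.
Proof.
move=> Bs nx xmin; apply/eigenpairP; split=> // k.
set l := 2 * c * quart x + qform B x; set m := c * quart x + qform B x.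
pose Bx i := \sum_j B i j * x j 0.
pose v i := 2 * c * x i 0 ^+ 3 + Bx i - l * x i 0.
suff /sumr_sqr_eq0/(_ k)/eqP : \sum_i v i ^+ 2 = 0.
  by rewrite subr_eq0 => /eqP.
pose p i : {poly R} := (x i 0)%:P + v i *: 'X.
pose P2 := \sum_i p i ^+ 2; pose P4 := \sum_i p i ^+ 4.
pose PQ := \sum_i p i * \sum_j B i j *: p j.
pose G := c *: P4 + PQ * P2 - m *: P2 ^+ 2.
pose y t : 'cV[R]_n := \col_i (x i 0 + v i * t).
have pE i t : (p i).[t] = y t i 0 by rewrite mxE /p !hornerE.
have p0 i : (p i).[0] = x i 0 by rewrite pE mxE mulr0 addr0.
have dp i : (p i)^`() = (v i)%:P by rewrite /p !poly.derivE alg_polyC add0r.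
have P2E t : P2.[t] = sqnorm (y t).
  by rewrite horner_sum; apply: eq_bigr => i _; rewrite horner_exp pE.
have P4E t : P4.[t] = quart (y t).
  by rewrite horner_sum; apply: eq_bigr => i _; rewrite horner_exp pE.
have PQE t : PQ.[t] = qform B (y t).
  rewrite horner_sum; apply: eq_bigr => i _; rewrite hornerM pE horner_sum.
  by congr (_ * _); apply: eq_bigr => j _; rewrite hornerZ pE.
have dsum (F : 'I_n -> {poly R}) : (\sum_i F i)^`() = \sum_i (F i)^`().
  exact: raddf_sum.
have y0 : y 0 = x by apply/matrixP => i j; rewrite mxE mulr0 addr0 ord1.
have GE t : G.[t] = c * quart (y t) + qform B (y t) * sqnorm (y t)
                    - m * sqnorm (y t) ^+ 2.
  by rewrite /G !(hornerE, horner_exp) P2E P4E PQE.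
have G0 : G.[0] = 0 by rewrite GE y0 nx expr1n !mulr1 subrr.
have /deriv_at_min : forall t, G.[0] <= G.[t].
  by move=> t; rewrite G0 GE subr_ge0; exact: homogeneous_min.
have dP2 : P2^`().[0] = 2 * \sum_i v i * x i 0.
  rewrite dsum horner_sum mulr_sumr; apply: eq_bigr => i _.
  rewrite deriv_exp dp hornerMn hornerM hornerC horner_exp p0 /=; ring.
have dP4 : P4^`().[0] = 4 * \sum_i v i * x i 0 ^+ 3.
  rewrite dsum horner_sum mulr_sumr; apply: eq_bigr => i _.
  rewrite deriv_exp dp hornerMn hornerM hornerC horner_exp p0 /=; ring.
have dPQ : PQ^`().[0] = 2 * \sum_i v i * Bx i.
  have polar : \sum_i x i 0 * \sum_j B i j * v j = \sum_i v i * Bx i.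
    have := qform_polar B x (\col_i v i) Bs.
    under eq_bigr do under eq_bigr do rewrite mxE.
    by move=> ->; apply: eq_bigr => i _; rewrite mxE.
  rewrite mulr_natl mulr2n -{2}polar -big_split /=.
  rewrite dsum horner_sum; apply: eq_bigr => i _.
  rewrite derivM dp dsum hornerD !hornerM hornerC !horner_sum p0.
  congr (_ * _ + _ * _); apply: eq_bigr => j _.
    by rewrite hornerZ p0.
  by rewrite derivZ dp !hornerE.
(* One factor v i of each square is expanded as the residual. *)
have vv : \sum_i v i ^+ 2 =
    2 * c * (\sum_i v i * x i 0 ^+ 3) + \sum_i v i * Bx i
    - l * \sum_i v i * x i 0.
  rewrite !mulr_sumr -big_split -sumrB; apply: eq_bigr => i _ /=.
  by rewrite expr2 {2}/v; ring.
rewrite vv /G !poly.derivE !hornerE.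
rewrite dP2 dP4 dPQ P2E PQE y0 nx /l /m.
by move=> /= ?; lra.
Qed.

(** * Symmetric M-matrices *)

Lemma Mmatrix_offdiag {R : realType} {n : nat} (B : 'M[R]_n) :
  Mmatrix B -> forall i j, i != j -> B i j <= 0.
Proof.
move=> [s [A [-> A_ge0 _]]] i j /negPf nij.
by rewrite !mxE nij mulr0n sub0r oppr_le0.
Qed.

(** The spectral radius is a supremum in the reals, which is only meaningful for
    bounded sets: the roots of the characteristic polynomial form a finite
    list, and the sum of their moduli is an upper bound. *)
Lemma real_eigenvalue_le_spectral_radius {R : realType} {n : nat}
    (A : 'M[R]_n) (a : R) :
  eigenvalue A a -> a <= spectral_radius A.
Proof.
move=> /eigenvalueP[v vA v0]; apply: le_trans (ler_norm a) _.
set Ac := map_mx (real_complex R) A.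
apply: ub_le_sup.
  have [r rE] := closed_field_poly_normal (char_poly Ac).
  exists (\sum_(z <- r) ComplexField.Normc.normc z) => _ [z [zA ->]].
  have zr : z \in r.
    move: zA; rewrite eigenvalue_root_char rE.
    by rewrite (monicP (char_poly_monic _)) scale1r root_prod_XsubC.
  rewrite (big_rem z zr) /= lerDl; apply: sumr_ge0 => -[? ?] _.
  exact: sqrtr_ge0.
exists (real_complex R a); split; last first.
  by rewrite /= expr0n addr0 sqrtr_sqr.
apply/eigenvalueP; exists (map_mx (real_complex R) v).
  by rewrite -map_mxM vA map_mxZ.
by rewrite map_mx_eq0.
Qed.

(** The minimum of [qform B] over the sphere is an eigenvalue [m] of [B], and
    [B = s%:M - A] turns it into the eigenvalue [s - m <= s] of [A]. *)
Lemma Mmatrix_qform_ge0 {R : realType} {n : nat} (B : 'M[R]_n) :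
  B^T = B -> Mmatrix B -> forall x, sqnorm x = 1 -> 0 <= qform B x.
Proof.
case: n B => [|n] B Bs [s [A [BE _ rhoA]]] x nx.
  by move: nx; rewrite /sqnorm big_ord0 => /eqP; rewrite eq_sym oner_eq0.
have [u nu umin] := sphere_min (ltn0Sn n) 0 B.
have uP := min_critical 0 B u Bs nu umin; have [uE _] := uP.
rewrite mulr0 !mul0r scale0r !add0r in uE.
have := umin x nx; rewrite !mul0r !add0r; apply: le_trans.
suff /real_eigenvalue_le_spectral_radius/le_trans/(_ rhoA) :
  eigenvalue A (s - qform B u) by rewrite gerBl.
apply/eigenvalueP; exists u^T.
  have -> : A = s%:M - B by rewrite BE opprB addrC subrK.
  rewrite mulmxBr mul_mx_scalar -{1}Bs -trmx_mul uE scalerBl.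
  by rewrite linearZ.
by rewrite trmx_eq0 (eigenpair_neq0 uP).
Qed.

(** * Nonnegative eigenvectors *)

Lemma qform_norm_le {R : realType} {n : nat} (B : 'M[R]_n) (x : 'cV[R]_n) :
  (forall i j, i != j -> B i j <= 0) ->
  qform B (map_mx Num.norm x) <= qform B x.
Proof.
move=> Boff; apply: ler_sum => i _; rewrite !mulr_sumr; apply: ler_sum => j _.
rewrite !mxE; have [<-|nij] := eqVneq i j.
  rewrite mulrCA [leRHS]mulrCA -!expr2.
  by rewrite real_normK ?num_real.
rewrite mulrCA [leRHS]mulrCA -normrM.
by apply: ler_wnM2l; [exact: Boff | exact: ler_norm].
Qed.

(** The entrywise absolute value of a minimizer of the energy is again a
    minimizer, hence an eigenvector. *)
Lemma exists_nonneg_eigenpair {R : realType} {n : nat} (alpha : R)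
    (B : 'M[R]_n) :
  (0 < n)%N -> B^T = B -> (forall i j, i != j -> B i j <= 0) ->
  exists l x, eigenpair alpha B l x /\ nonneg_mx x.
Proof.
move=> n_gt0 Bs Boff; have [x nx xmin] := sphere_min n_gt0 (alpha / 2) B.
(* Even powers do not see signs; the cases k = 1, 2 give sqnorm and quart. *)
have nxE k : (\sum_i (map_mx Num.norm x) i 0 ^+ k.*2) = \sum_i x i 0 ^+ k.*2.
  apply: eq_bigr => i _.
  by rewrite mxE -mul2n !exprM real_normK ?num_real.
have nw : sqnorm (map_mx Num.norm x) = 1 by rewrite -nx /sqnorm (nxE 1%N).
have qw : quart (map_mx Num.norm x) = quart x by rewrite /quart (nxE 2%N).
have := min_critical (alpha / 2) B _ Bs nw.
have -> : 2 * (alpha / 2) = alpha by field.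
rewrite qw => crit.
exists (alpha * quart x + qform B (map_mx Num.norm x)), (map_mx Num.norm x).
split; last by move=> i j; rewrite mxE.
apply: crit => y ny; apply: le_trans (xmin y ny); rewrite lerD2l.
exact: qform_norm_le.
Qed.

(** At an index [i] with [x_i = 0] the equation reads [\sum_j B i j * x_j = 0],
    with all terms nonpositive.  So [B i j = 0] whenever [x_j != 0], and the
    zero set of [x] would witness reducibility if it were nonempty. *)
Lemma nonneg_eigenvector_pos {R : realType} {n : nat} (alpha l : R)
    (B : 'M[R]_n) (x : 'cV[R]_n) :
  irreducible_mx B -> (forall i j, i != j -> B i j <= 0) ->
  eigenpair alpha B l x -> nonneg_mx x -> pos_mx x.
Proof.
move=> Birr Boff xP x_ge0; have /eigenpairP[xE _] := xP.
pose I := [set i | x i 0 == 0]%SET.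
have [I0|In0] := eqVneq I finset.set0.
  move=> i j; rewrite ord1 lt_neqAle x_ge0 eq_sym andbT.
  by have := finset.in_set0 i; rewrite -I0 inE => ->.
case: Birr; exists I; split=> //.
  rewrite properT; apply: contra (eigenpair_neq0 xP) => /eqP IT.
  apply/eqP/matrixP => i j; have : i \in I by rewrite IT inE.
  by rewrite inE ord1 mxE => /eqP.
move=> i j; rewrite !inE => /eqP xi xj.
have negterm_ge0 k : 0 <= - (B i k * x k 0).
  have [<-|nik] := eqVneq i k; first by rewrite xi mulr0 oppr0.
  by rewrite oppr_ge0 mulr_le0_ge0 // Boff.
have sum0 : \sum_k - (B i k * x k 0) = 0.
  have := xE i; rewrite xi expr0n !mulr0 add0r sumrN => ->.
  by rewrite oppr0.
have /(_ j isT)/eqP := psumr_eq0P (fun k _ => negterm_ge0 k) sum0.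
by rewrite oppr_eq0 mulf_eq0 (negPf xj) orbF => /eqP.
Qed.

(** * Comparison with an arbitrary eigenvector *)

(** With [sign_row_eq], this says that [|y|] is a subsolution of the equation
    satisfied by [y]: replacing [y_j] by [|y_j|] lowers each term of row [i],
    once that row is multiplied by the sign of [y_i]. *)
Lemma sign_row_term_le {R : realType} {n : nat} {B : 'M[R]_n} (y : 'cV[R]_n)
    i j :
  (forall i j, i != j -> B i j <= 0) ->
  B i j * `|y j 0| <= (-1) ^+ (y i 0 < 0)%R * (B i j * y j 0).
Proof.
move=> Boff; have [<-|nij] := eqVneq i j.
  by rewrite mulrCA -normrEsign.
rewrite mulrCA; apply: ler_wnM2l; first exact: Boff.
apply: le_trans (ler_norm _) _.
by rewrite normrM normrX normrN1 expr1n mul1r.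
Qed.

Lemma sign_row_eq {R : realType} {n : nat} {alpha mu : R} {B : 'M[R]_n}
    {y : 'cV[R]_n} i :
  eigenpair alpha B mu y ->
  alpha * `|y i 0| ^+ 3
    + \sum_j (-1) ^+ (y i 0 < 0)%R * (B i j * y j 0) = mu * `|y i 0|.
Proof.
move=> /eigenpairP[yE _].
rewrite -mulr_sumr normrEsign; set e := (-1) ^+ _.
have e2 : e ^+ 2 = 1 by rewrite sqrr_sign.
have -> : (e * y i 0) ^+ 3 = e * y i 0 ^+ 3.
  by rewrite exprMn exprS e2 mulr1.
by rewrite mulrCA -mulrDr yE mulrCA.
Qed.

(** The multiple [s * x] touches [|y|] from above at the index [i] where the
    ratio [|y_i| / x_i] is largest.  There the off-diagonal terms favour
    [|y|], while the cubic term costs [s^2] times more than in the equation of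
    [x]; since [s >= 1], this excess is absorbed by [mu - l]. *)
Lemma pos_eigenvalue_minimal {R : realType} {n : nat} (alpha l mu : R)
    (B : 'M[R]_n) (x y : 'cV[R]_n) :
  0 < alpha -> (forall i j, i != j -> B i j <= 0) ->
  eigenpair alpha B l x -> pos_mx x -> eigenpair alpha B mu y ->
  l <= mu /\ (l = mu -> forall i, `|y i 0| = x i 0).
Proof.
move=> alpha_gt0 Boff xP x_gt0 yP.
have [/eigenpairP[xE nx] /eigenpairP[yE ny]] := (xP, yP).
case: n => [|n] in B x y Boff xP x_gt0 yP xE nx yE ny *.
  by move: nx; rewrite /sqnorm big_ord0 => /eqP; rewrite eq_sym oner_eq0.
pose q i := `|y i 0| / x i 0.
have [i _ imax] :=
  Order.TotalTheory.arg_maxP q (erefl : xpredT (ord0 : 'I_n.+1)).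
set s := q i in imax.
have s_ge0 : 0 <= s by rewrite divr_ge0 // ltW.
have yle j : `|y j 0| <= s * x j 0 by rewrite -ler_pdivrMr //; exact: imax.
have yi : `|y i 0| = s * x i 0 by rewrite divfK // gt_eqF.
have s2_ge1 : 1 <= s ^+ 2.
  rewrite -ny -[leRHS]mulr1 -nx /sqnorm mulr_sumr; apply: ler_sum => j _.
  rewrite -exprMn -[y j 0 ^+ 2]real_normK ?num_real //.
  by rewrite lerXn2r // nnegrE // mulr_ge0 // ltW.
have s_gt0 : 0 < s.
  rewrite lt_neqAle s_ge0 andbT; apply/eqP => s0.
  by move: s2_ge1; rewrite -s0 expr0n ler10.
have key : l + alpha * (s ^+ 2 - 1) * x i 0 ^+ 2 <= mu.
  have sx_gt0 : 0 < s * x i 0 by rewrite mulr_gt0.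
  rewrite -(ler_pM2r sx_gt0) -{2}yi -(sign_row_eq i yP) yi.
  have : \sum_j s * (B i j * x j 0)
      <= \sum_j (-1) ^+ (y i 0 < 0)%R * (B i j * y j 0).
    apply: ler_sum => j _; apply: le_trans (sign_row_term_le _ _ _ Boff).
    have [<-|nij] := eqVneq i j; first by rewrite yi mulrCA.
    by rewrite mulrCA; apply: ler_wnM2l; [exact: Boff | exact: yle].
  rewrite -mulr_sumr => le_sum.
  have := xE i; set t := \sum_j B i j * x j 0 in le_sum *; move=> xEi.
  have -> : (l + alpha * (s ^+ 2 - 1) * x i 0 ^+ 2) * (s * x i 0) =
     alpha * (s * x i 0) ^+ 3 + s * (l * x i 0 - alpha * x i 0 ^+ 3) by ring.
  by rewrite lerD2l -xEi addrAC subrr add0r.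
have gap_ge0 : 0 <= alpha * (s ^+ 2 - 1) * x i 0 ^+ 2.
  by rewrite mulr_ge0 ?sqr_ge0 // mulr_ge0 ?subr_ge0 // ltW.
split; first by apply: le_trans key; rewrite lerDl.
move=> lmu; move: key; rewrite -lmu gerDl => gap_le0.
have s1 : s = 1.
  have /eqP : alpha * (s ^+ 2 - 1) * x i 0 ^+ 2 = 0.
    by apply/eqP; rewrite eq_le gap_le0.
  rewrite mulf_eq0 expf_eq0 /= (gt_eqF (x_gt0 i 0)) orbF.
  rewrite mulf_eq0 (gt_eqF alpha_gt0) /= subr_eq0.
  by rewrite sqrp_eq1 // => /eqP.
have yx j : `|y j 0| <= x j 0 by have := yle j; rewrite s1 mul1r.
have d_ge0 j : 0 <= x j 0 ^+ 2 - y j 0 ^+ 2.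
  rewrite subr_ge0 -[y j 0 ^+ 2]real_normK ?num_real //.
  by rewrite lerXn2r // nnegrE // ltW.
have sd : \sum_j (x j 0 ^+ 2 - y j 0 ^+ 2) = 0.
  by rewrite sumrB -/(sqnorm x) -/(sqnorm y) nx ny subrr.
move=> j; apply/eqP.
rewrite -(@eqrXn2 _ 2) ?(ltW (x_gt0 _ _)) // real_normK ?num_real //.
by rewrite eq_sym -subr_eq0 (psumr_eq0P (fun j _ => d_ge0 j) sd).
Qed.

(** Since [|y| = x] solves the same equation as [y], the termwise inequalities
    of [sign_row_term_le] are all equalities.  An entry [B i j] with [y_i > 0]
    and [y_j < 0] must then vanish, so the set of positive entries of [y] is
    empty or full. *)
Lemma pos_eigenvector_sign {R : realType} {n : nat} (alpha l : R)
    (B : 'M[R]_n) (x y : 'cV[R]_n) :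
  irreducible_mx B -> (forall i j, i != j -> B i j <= 0) ->
  eigenpair alpha B l x -> pos_mx x -> eigenpair alpha B l y ->
  (forall i, `|y i 0| = x i 0) -> y = x \/ y = - x.
Proof.
move=> Birr Boff xP x_gt0 yP yx.
have y_neq0 i : y i 0 != 0 by rewrite -normr_gt0 yx.
have termE i j :
    B i j * `|y j 0| = (-1) ^+ (y i 0 < 0)%R * (B i j * y j 0).
  pose d k := (-1) ^+ (y i 0 < 0)%R * (B i k * y k 0) - B i k * `|y k 0|.
  have d_ge0 k : 0 <= d k.
    by rewrite subr_ge0 sign_row_term_le.
  have sd : \sum_k d k = 0.
    have := sign_row_eq i yP; rewrite yx; have /eigenpairP[/(_ i) <- _] := xP.
    move=> /addrI; rewrite sumrB => ->; under eq_bigr do rewrite -yx.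
    by rewrite subrr.
  apply/eqP; rewrite eq_sym -subr_eq0 -/(d j).
  by rewrite (psumr_eq0P (fun k _ => d_ge0 k) sd).
pose I := [set i | 0 < y i 0]%SET.
have [I0|In0] := eqVneq I finset.set0.
  right; apply/matrixP => i j; rewrite ord1 mxE -yx ltr0_norm ?opprK //.
  rewrite lt_neqAle y_neq0 /= leNgt.
  by have := finset.in_set0 i; rewrite -I0 inE => ->.
have [IT|InT] := eqVneq I [set: 'I_n]%SET.
  left; apply/matrixP => i j; rewrite ord1 -yx gtr0_norm //.
  by have := finset.in_setT i; rewrite -IT inE.
case: Birr; exists I; split=> //; first by rewrite properT.
move=> i j; rewrite !inE => yi; rewrite -leNgt => yj.
have /eqP := termE i j; rewrite (lt_gtF yi) expr0 mul1r ler0_norm //.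
rewrite -subr_eq0 -mulrBr mulf_eq0 => /orP[/eqP //|].
by rewrite -opprD oppr_eq0 -mulr2n mulrn_eq0 (negPf (y_neq0 j)).
Qed.

(** * The smallest eigenvalue *)

Lemma eigenpair_opp {R : realType} {n : nat} {alpha l : R} {B : 'M[R]_n}
    {x : 'cV[R]_n} :
  eigenpair alpha B l x -> eigenpair alpha B l (- x).
Proof.
move=> /eigenpairP[xE nx]; apply/eigenpairP; split.
  move=> i; rewrite !mxE mulrN -xE opprD; congr (_ + _); first by ring.
  by rewrite -sumrN; apply: eq_bigr => j _; rewrite mxE mulrN.
by rewrite -nx; apply: eq_bigr => i _; rewrite mxE sqrrN.
Qed.

(** Inner product of the eigenvalue equation with the unit vector [x]. *)
Lemma eigenvalueE {R : realType} {n : nat} {alpha l : R} {B : 'M[R]_n}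
    {x : 'cV[R]_n} :
  eigenpair alpha B l x -> l = alpha * quart x + qform B x.
Proof.
move=> /eigenpairP[xE nx]; rewrite -[LHS]mulr1 -nx /sqnorm /quart !mulr_sumr.
rewrite /qform -big_split; apply: eq_bigr => i _ /=.
by rewrite expr2 mulrA -xE; ring.
Qed.

Lemma eigenvalue_gt0 {R : realType} {n : nat} {alpha l : R} {B : 'M[R]_n}
    {x : 'cV[R]_n} :
  0 < alpha -> B^T = B -> Mmatrix B -> eigenpair alpha B l x -> 0 < l.
Proof.
move=> alpha_gt0 Bs BM xP; have /eigenpairP[_ nx] := xP.
rewrite (eigenvalueE xP) ltr_wpDr ?Mmatrix_qform_ge0 // mulr_gt0 //.
have sqr4 i : x i 0 ^+ 4 = (x i 0 ^+ 2) ^+ 2 by rewrite -exprM.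
rewrite lt_neqAle sumr_ge0 ?andbT => [|i _]; last by rewrite sqr4 sqr_ge0.
apply: contra (eigenpair_neq0 xP) => /eqP q0; apply/eqP/matrixP => i j.
rewrite ord1 mxE; apply/eqP; rewrite -sqrf_eq0; apply/eqP.
apply: (@sumr_sqr_eq0 _ _ (fun i => x i 0 ^+ 2)).
by rewrite [RHS]q0; apply: eq_bigr => k _; rewrite sqr4.
Qed.

(** A family of eigenvectors among [x] and [- x] spans at most a line. *)
Lemma geometrically_simple_pm {R : realType} {n : nat} {alpha l : R}
    {B : 'M[R]_n} {x : 'cV[R]_n} :
  eigenpair alpha B l x ->
  (forall y, eigenpair alpha B l y -> y = x \/ y = - x) ->
  geometrically_simple alpha B l.
Proof.
move=> xP only_pm; split.
  exists x^T; split; last by move=> i; rewrite ord1 row_id trmxK.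
  by rewrite /row_free rank_rV trmx_eq0 (eigenpair_neq0 xP).
move=> k [X [/eqP rX XP]]; rewrite -rX; apply: leq_trans (rank_leq_row x^T).
apply: mxrankS; apply/row_subP => i; rewrite -[row i X]trmxK.
by case: (only_pm _ (XP i)) => ->; rewrite ?linearN ?eqmx_opp.
Qed.

Theorem lemma3p7 (R : realType) (n : nat) (alpha : R) (B : 'M[R]_n)
    (n_gt0 : (0 < n)%N) (alpha_gt0 : 0 < alpha)
    (B_sym : B^T = B) (B_irr : irreducible_mx B) (B_M : Mmatrix B) :
  (exists (lambda : R) (x : 'cV[R]_n),
      eigenpair alpha B lambda x /\ nonneg_mx x)
  /\
  ((forall (lambda mu : R) (x y : 'cV[R]_n),
      eigenpair alpha B lambda x -> eigenpair alpha B mu y ->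
      nonneg_mx x -> nonneg_mx y -> lambda = mu)
   /\
   (forall (lambda : R) (x : 'cV[R]_n),
      eigenpair alpha B lambda x -> nonneg_mx x -> pos_mx x))
  /\
  (forall (lambda0 : R),
      (exists x0 : 'cV[R]_n, eigenpair alpha B lambda0 x0 /\ nonneg_mx x0) ->
      [/\ forall lambda : R, nl_eigenvalue alpha B lambda -> lambda0 <= lambda,
          0 < lambda0,
          geometrically_simple alpha B lambda0
        & exists u v : 'cV[R]_n,
            [/\ nonneg_mx u, nonpos_mx v, u <> v
              & forall x : 'cV[R]_n,
                  eigenpair alpha B lambda0 x <-> x = u \/ x = v]]).
Proof.
have Boff := Mmatrix_offdiag B B_M.
have pos l x := nonneg_eigenvector_pos alpha l B x B_irr Boff.
have minimal l mu x y :
    eigenpair alpha B l x -> nonneg_mx x -> eigenpair alpha B mu y ->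
    l <= mu /\ (l = mu -> forall i, `|y i 0| = x i 0).
  by move=> xP x_ge0; apply: pos_eigenvalue_minimal xP (pos _ _ xP x_ge0).
split; first exact: exists_nonneg_eigenpair.
split.
  split=> [l mu x y xP yP x_ge0 y_ge0|]; last exact: pos.
  apply/eqP; rewrite eq_le.
  by rewrite (minimal _ _ _ _ xP x_ge0 yP).1 (minimal _ _ _ _ yP y_ge0 xP).1.
move=> l0 [x [xP x_ge0]]; have x_gt0 := pos _ _ xP x_ge0.
have only_pm y : eigenpair alpha B l0 y -> y = x \/ y = - x.
  move=> yP; apply: (pos_eigenvector_sign _ _ _ _ _ B_irr Boff xP x_gt0 yP).
  exact: (minimal _ _ _ _ xP x_ge0 yP).2.
split.
- move=> mu [y yP]; exact: (minimal _ _ _ _ xP x_ge0 yP).1.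
- exact: (eigenvalue_gt0 alpha_gt0 B_sym B_M xP).
- exact: geometrically_simple_pm xP only_pm.
- exists x, (- x); split=> //.
  + by move=> i j; rewrite mxE oppr_le0.
  + move=> /matrixP/(_ (Ordinal n_gt0) 0); rewrite mxE => xE.
    have := x_gt0 (Ordinal n_gt0) 0; rewrite -[X in _ < X]opprK -xE.
    by rewrite oppr_gt0 ltNge x_ge0.
  + move=> y; split; first exact: only_pm.
    by case=> ->; [|exact: eigenpair_opp].
Qed.
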